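(* Let $V,W\subset X$ be subspaces. Given bases $(v_1,\dots,v_p)$ of $V$ and $(w_1,\dots,w_q)$ of $W$, let $A=(\langle w_i,w_j\rangle)$ (a $q\times q$ matrix), $B=(\langle w_i,v_j\rangle)$ (a $q\times p$ matrix) and $D=(\langle v_i,v_j\rangle)$ (a $p\times p$ matrix). Then $$\cos^2\Theta^\perp_{V,W}=\frac{\det(A-BD^{-1}\bar{B}^T)}{\det A}.$$
   Context: $X$ is an $n$-dimensional vector space over $\mathbb{R}$ (real case) or $\mathbb{C}$ (complex case) with an inner product $\langle\cdot,\cdot\rangle$ (Hermitian in the complex case, conjugate-linear in the left entry). Subspaces and dimensions are over the same field. $\bar B^T$ is the conjugate transpose of $B$. Principal angles: for nonzero subspaces $V,W\subset X$, with $p=\dim V$, $q=\dim W$, $m=\min\{p,q\}$, there are orthonormal bases $(e_1,\dots,e_p)$ of $V$ and $(f_1,\dots,f_q)$ of $W$ and uniquely determined numbers $0\le\theta_1\le\dots\le\theta_m\le\frac{\pi}{2}$ (the principal angles) such that $\langle e_i,f_j\rangle=\delta_{ij}\cos\theta_i$ (equal to $0$ whenever $i\neq j$). Grassmann angle: for nonzero subspaces $V,W\subset X$ with principal angles $\theta_1,\dots,\theta_m$, the Grassmann angle $\Theta_{V,W}\in[0,\frac{\pi}{2}]$ of $V$ with $W$ is $\Theta_{V,W}=\arccos(\cos\theta_1\cdots\cos\theta_m)$ if $\dim V\le\dim W$, and $\Theta_{V,W}=\frac{\pi}{2}$ if $\dim V>\dim W$. Also $\Theta_{\{0\},\{0\}}=\Theta_{\{0\},V}=0$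 and $\Theta_{V,\{0\}}=\frac{\pi}{2}$ for $V\ne\{0\}$. The complementary Grassmann angle of $V,W$ is $\Theta^\perp_{V,W}=\Theta_{V,W^\perp}$, where $W^\perp$ is the orthogonal complement of $W$ in $X$. *)

(* Defs.v *)
From HB Require Import structures.
From mathcomp Require Import all_boot all_order all_algebra.
From mathcomp Require Import all_classical all_reals.
From mathcomp Require Import trigo.
From mathcomp Require Import complex.

Set Implicit Arguments.
Unset Strict Implicit.
Unset Printing Implicit Defensive.

Import Order.TTheory GRing.Theory Num.Theory.
Local Open Scope ring_scope.
Local Open Scope classical_set_scope.

Inductive scalars := RealScalars | ComplexScalars.

Definition scalar_field (R : realType) (s : scalars) : numFieldType :=
  match s with
  | RealScalars => R
  | ComplexScalars => R[i]
  end.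

Definition scalar_conj (R : realType) (s : scalars) :
    {rmorphism scalar_field R s -> scalar_field R s} :=
  match s with
  | RealScalars => idfun
  | ComplexScalars => Num.conj
  end.

Definition scalar_of_real (R : realType) (s : scalars) :
    {rmorphism R -> scalar_field R s} :=
  match s with
  | RealScalars => idfun
  | ComplexScalars => @real_complex R
  end.

Section GrassmannAngle.

Variables (R : realType) (s : scalars) (X : vectType (scalar_field R s)).
Variable dot : {dot X for scalar_conj R s}.
Implicit Types V W : {vspace X}.

(* A form [dot] of type {dot _ for _} is linear in its first argument and
   conjugate-linear in the second; [inner] swaps the arguments, so that
   <u, v> is conjugate-linear in u. *)
Definition inner (u v : X) : scalar_field R s := dot v u.

Definition orthonormal_basis V (e : seq X) : bool :=
  basis_of V e && orthonormal dot e.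

Definition is_principal_angles V W
    (theta : (minn (\dim V) (\dim W)).-tuple R) : Prop :=
  [/\ forall i, 0 <= tnth theta i <= pi / 2,
      sorted <=%R theta &
      exists (e : (\dim V).-tuple X) (f : (\dim W).-tuple X),
        [/\ orthonormal_basis V e, orthonormal_basis W f &
            forall (i : 'I_(\dim V)) (j : 'I_(\dim W)),
              inner (tnth e i) (tnth f j) =
              if i == j :> nat then scalar_of_real R s (cos theta`_i) else 0]].

(* Principal angles exist and are unique for all V and W, so the default value
   of [xget] is never used. *)
Definition principal_angles V W : (minn (\dim V) (\dim W)).-tuple R :=
  xget [tuple of nseq _ 0] [set theta | is_principal_angles theta].

Definition grassmann_angle V W : R :=
  if V == 0%VS then 0
  else if W == 0%VS then pi / 2
  else if (\dim V <= \dim W)%N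
       then acos (\prod_(t <- principal_angles V W) cos t)
       else pi / 2.

Definition compl_grassmann_angle V W : R := grassmann_angle V (orthov dot W).

End GrassmannAngle.

(* Main.v *)
Require Import Defs.
From HB Require Import structures.
From mathcomp Require Import all_boot all_order all_algebra.
From mathcomp Require Import all_classical all_reals.
From mathcomp Require Import trigo.
From mathcomp Require Import complex.

Set Implicit Arguments.
Unset Strict Implicit.
Unset Printing Implicit Defensive.

Import Order.TTheory GRing.Theory Num.Theory.
Local Open Scope ring_scope.

(** Let [P] be the orthogonal projection on the orthogonal complement [W^_|_]
    and [C] the conjugate transpose of [B].  Both sides are the factor by which
    [P] contracts squared [p]-dimensional volumes of [V], that is, the ratio
    [det (<P v_i, P v_j>) / det D].

    On the algebraic side, subtracting from each [v_j] its projection on [W]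
    leaves [P v_j], and the Gram matrix of these residuals is the Schur
    complement [D - C A^-1 B] ([gram_residual]).  Computing the determinant of
    the block matrix with blocks [A, B, C, D] by eliminating either diagonal
    block gives [det A * det (D - C A^-1 B) = det D * det (A - B D^-1 C)]
    ([det_schur_exchange]), which turns the ratio into the stated one.

    On the geometric side ([cos_grassmann_angle_gram]), if [V] has larger
    dimension than the target, the projected vectors are dependent and the
    Grassmann angle is a right angle.  Otherwise, in principal bases, [P] maps
    [e_i] to [cos theta_i *: f_i], so its determinant is the product of the
    [cos theta_i].

    The Grassmann angle is defined by choosing principal angles, so their
    existence has to be proved: this is the singular value decomposition of the
    matrix of inner products between two orthonormal bases.  One singular pair
    comes from an eigenvector of [M M^*] ([singular_pair]); over the reals the
    eigenvalue exists because a complex eigenvalue of a real symmetric matrix is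
    real ([real_symmetric_eigenvalue]).  Splitting off the pair and passing to
    orthogonal complements gives the whole system by induction
    ([singular_system]), which is finally sorted ([principal_angles_exist]). *)

(** * Gram matrices and Schur complements *)

(** Both sides equal the determinant of the block matrix with rows [A B] and
    [C D], factored through one or the other diagonal block. *)
Lemma det_schur_exchange (F : fieldType) (q p : nat) (A : 'M[F]_q)
    (B : 'M[F]_(q, p)) (C : 'M[F]_(p, q)) (D : 'M[F]_p) :
  A \in unitmx -> D \in unitmx ->
  \det A * \det (D - C *m invmx A *m B) =
  \det D * \det (A - B *m invmx D *m C).
Proof.
move=> uA uD; transitivity (\det (block_mx A B C D)).
  have -> : block_mx A B C D =
      block_mx A 0 C (D - C *m invmx A *m B) *m block_mx 1%:M (invmx A *m B) 0 1%:M.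
    by rewrite mulmx_block !mulmx1 !mul0mx !mulmx0 !addr0 mulKVmx // mulmxA addrC subrK.
  by rewrite det_mulmx det_lblock det_ublock !det1 !mulr1.
have -> : block_mx A B C D =
    block_mx (A - B *m invmx D *m C) B 0 D *m block_mx 1%:M 0 (invmx D *m C) 1%:M.
  by rewrite mulmx_block !mulmx1 !mul0mx !mulmx0 !add0r mulKVmx // mulmxA subrK.
by rewrite det_mulmx det_lblock det_ublock !det1 !mulr1 mulrC.
Qed.

Section Gram.

Variables (K : numFieldType) (theta : {rmorphism K -> K}) (X : vectType K).
Variable dot : {dot X for theta}.

Lemma dot_conj u v : theta (dot u v) = dot v u.
Proof. by rewrite [RHS]hermC mul1r. Qed.

Lemma dot_ge0 u : 0 <= dot u u.
Proof.
by have [->|u0] := eqVneq u 0; rewrite ?linear0r // ltW // neq0_dnorm_gt0.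
Qed.

Lemma dot_eq0 u : (dot u u == 0) = (u == 0).
Proof.
have [->|u0] := eqVneq u 0; first by rewrite linear0r eqxx.
by rewrite gt_eqF // neq0_dnorm_gt0.
Qed.

(** The arguments of [dot] are swapped so that the entries are [<a_i, b_j>],
    conjugate-linear in [a]. *)
Definition gram m n (a : 'I_m -> X) (b : 'I_n -> X) : 'M[K]_(m, n) :=
  \matrix_(i, j) dot (b j) (a i).

Definition lincomb m n (M : 'M[K]_(m, n)) (a : 'I_n -> X) (i : 'I_m) : X :=
  \sum_k M i k *: a k.

Lemma gram_lincombr m n l (a : 'I_m -> X) (N : 'M_(n, l)) (b : 'I_l -> X) :
  gram a (lincomb N b) = gram a b *m N^T.
Proof.
apply/matrixP => i j; rewrite !mxE linear_sumlz; apply: eq_bigr => k _.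
by rewrite linearZl_LR !mxE mulrC.
Qed.

Lemma gram_conj m n (a : 'I_m -> X) (b : 'I_n -> X) :
  (map_mx theta (gram a b))^T = gram b a.
Proof. by apply/matrixP => i j; rewrite !mxE dot_conj. Qed.

Lemma gram_lincombl m n l (M : 'M_(m, l)) (a : 'I_l -> X) (b : 'I_n -> X) :
  gram (lincomb M a) b = map_mx theta M *m gram a b.
Proof.
apply/matrixP => i j; rewrite !mxE linear_sumr; apply: eq_bigr => k _.
by rewrite linearZr_LR !mxE.
Qed.

(** If [x] is in the kernel of the Gram matrix, the combination of [a] with
    coefficients [x] has norm zero. *)
Lemma free_gram_unit n (a : n.-tuple X) :
  free a -> gram (tnth a) (tnth a) \in unitmx.
Proof.
move=> /freeP fa; rewrite -unitmx_tr -row_free_unit.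
apply: inj_row_free => x xG0.
have Gx0 : gram (tnth a) (lincomb x (tnth a)) = 0.
  by rewrite gram_lincombr -[gram _ _]trmxK -trmx_mul xG0 trmx0.
have /matrixP/(_ 0 0) : gram (lincomb x (tnth a)) (lincomb x (tnth a)) = 0.
  by rewrite gram_lincombl Gx0 mulmx0.
rewrite !mxE => /eqP; rewrite dot_eq0 => /eqP x0.
apply/rowP => i; rewrite mxE; apply: (fa (fun j => x 0 j)).
by rewrite -[RHS]x0; apply: eq_bigr => k _; rewrite (tnth_nth 0).
Qed.

Lemma lincomb_coord n (V : {vspace X}) (a : n.-tuple X) m (u : 'I_m -> X) :
  basis_of V a -> (forall i, u i \in V) ->
  u = lincomb (\matrix_(i, j) coord a j (u i)) (tnth a).
Proof.
move=> ba uV; apply/funext => i; rewrite {1}(coord_basis ba (uV i)).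
by apply: eq_bigr => k _; rewrite mxE (tnth_nth 0).
Qed.

Lemma gram_lincomb m n (M : 'M_(m, n)) (a : 'I_n -> X) :
  gram (lincomb M a) (lincomb M a) = map_mx theta M *m gram a a *m M^T.
Proof. by rewrite gram_lincombr gram_lincombl. Qed.

Lemma mem_orthov_basis n (W : {vspace X}) (w : n.-tuple X) u :
  basis_of W w -> (forall i, dot u (tnth w i) = 0) -> u \in orthov dot W.
Proof.
move=> bw uw; apply/mem_orthovP => y yW.
rewrite (coord_basis bw yW) linear_sumr big1 // => i _.
by rewrite linearZr_LR /= -(tnth_nth 0 w) uw mulr0.
Qed.

Section Residual.

Variables (p q : nat) (v : 'I_p -> X) (W : {vspace X}) (w : q.-tuple X).
Hypothesis bw : basis_of W w.

(** The coefficients solve the normal equations [<w_i, v_j - sum_k c_kj w_k> = 0],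
    so [residual j] is the orthogonal projection of [v j] on the complement of
    [W]. *)
Definition residual (j : 'I_p) : X :=
  v j - lincomb (invmx (gram (tnth w) (tnth w)) *m gram (tnth w) v)^T (tnth w) j.

Lemma residual_orthov j : residual j \in orthov dot W.
Proof.
apply: (mem_orthov_basis bw) => i; rewrite /residual linearBl /=.
have /matrixP/(_ i j) := gram_lincombr (tnth w)
  (invmx (gram (tnth w) (tnth w)) *m gram (tnth w) v)^T (tnth w).
rewrite trmxK mulKVmx ?free_gram_unit ?(basis_free bw) //.
by rewrite !mxE => ->; rewrite subrr.
Qed.

Lemma orthov_dot_residual u j :
  u \in orthov dot W -> dot u (residual j) = dot u (v j).
Proof.
move=> /mem_orthovP uW; rewrite /residual linearBr /= [X in _ - X](_ : _ = 0) ?subr0 //.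
rewrite linear_sumr big1 // => k _; rewrite linearZr_LR /= uW ?mulr0 //.
by rewrite -(span_basis bw) memv_span // mem_tnth.
Qed.

(** As [residual i] is orthogonal to [W], pairing it with [residual j] is the
    same as pairing it with [v j], so the correction by vectors of [W] is
    subtracted only once. *)
Lemma gram_residual :
  gram residual residual =
  gram v v - gram v (tnth w) *m invmx (gram (tnth w) (tnth w)) *m gram (tnth w) v.
Proof.
apply/matrixP => i j; rewrite mxE orthov_dot_residual ?residual_orthov //.
rewrite /residual linearBl /= -mulmxA !mxE; congr (_ - _).
have /matrixP/(_ i j) := gram_lincombr v
  (invmx (gram (tnth w) (tnth w)) *m gram (tnth w) v)^T (tnth w).
by rewrite trmxK !mxE => ->.
Qed.

End Residual.

End Gram.

(** * Orthonormal sequences *)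

Section Orthonormal.

Variables (K : numFieldType) (theta : {rmorphism K -> K}) (X : vectType K).
Variable dot : {dot X for theta}.
Implicit Types (V W : {vspace X}) (s t : seq X).

Lemma dotC0 u v : dot u v = 0 -> dot v u = 0.
Proof. by rewrite -(dot_conj dot u v) => ->; rewrite rmorph0. Qed.

Lemma orthonormal_cons u s :
  orthonormal dot (u :: s) =
  [&& dot u u == 1, all [pred v | dot u v == 0] s & orthonormal dot s].
Proof.
by rewrite /orthonormal /= /ortho_rec /= andbT -!andbA; do !bool_congr.
Qed.

(** Unlike the recursive definition, this form is invariant under permutation
    of [s]. *)
Lemma orthonormal_dotP s :
  reflect (uniq s /\ {in s &, forall u v, dot u v = (u == v)%:R})
          (orthonormal dot s).
Proof.
elim: s => [|u s IHs]; first by left; split.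
rewrite orthonormal_cons; apply: (iffP and3P).
  case=> /eqP u1 /allP us /IHs [uniq_s dot_s].
  have uNs : u \notin s.
    by apply/negP => /us /=; rewrite u1 oner_eq0.
  split; first by rewrite /= uNs.
  move=> x y; rewrite !inE => /predU1P[->|xs] /predU1P[->|ys].
  - by rewrite eqxx.
  - have /eqP -> := us y ys; case: eqP => // uy; by rewrite uy ys in uNs.
  - rewrite dotC0 //; last exact/eqP/us.
    by case: eqP => // uy; rewrite -uy xs in uNs.
  - exact: dot_s.
case=> /= /andP[uNs uniq_s] dot_s; split.
- by rewrite dot_s ?mem_head // eqxx.
- apply/allP => v vs /=; rewrite dot_s ?mem_head ?inE ?vs ?orbT //.
  by case: (u =P v) => [uv|_ /[!eqxx]]; first by rewrite uv vs in uNs.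
- apply/IHs; split=> // x y xs ys; apply: dot_s.
    by rewrite inE xs orbT.
  by rewrite inE ys orbT.
Qed.

Lemma perm_orthonormal s t : perm_eq s t -> orthonormal dot s -> orthonormal dot t.
Proof.
move=> pst /orthonormal_dotP[us ds]; apply/orthonormal_dotP.
by split=> [|x y]; rewrite -?(perm_uniq pst) // -!(perm_mem pst); apply: ds.
Qed.

Lemma gram_orthonormal n (a : n.-tuple X) :
  orthonormal dot a -> gram dot (tnth a) (tnth a) = 1%:M.
Proof.
case/orthonormal_dotP=> ua da; apply/matrixP => i j.
rewrite !mxE da ?mem_tnth // !(tnth_nth 0) nth_uniq ?size_tuple //.
by rewrite eq_sym.
Qed.

Lemma dim_orthov_line V u : u \in V -> u != 0 ->
  \dim V = (\dim (V :&: orthov dot <[u]>)).+1.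
Proof.
move=> uV u0; rewrite -eq_dim_orthov1 ?prednK //.
  by rewrite lt0n dimv_eq0; apply: contraNneq u0 => V0; rewrite -memv0 -V0.
by apply/negP => /mem_orthovP/(_ _ uV)/eqP; rewrite dot_eq0 (negPf u0).
Qed.

(** Splitting off one unit vector: the induction step behind every orthonormal
    basis built below. *)
Lemma orthonormal_basis_cons V u s : u \in V -> dot u u = 1 ->
  basis_of (V :&: orthov dot <[u]>) s -> orthonormal dot s ->
  basis_of V (u :: s) /\ orthonormal dot (u :: s).
Proof.
move=> uV u1 bs os.
have u0 : u != 0 by rewrite -(dot_eq0 dot) u1 oner_eq0.
split; last first.
  rewrite orthonormal_cons u1 eqxx os andbT /=; apply/allP => y ys /=.
  have := memv_span ys; rewrite (span_basis bs) memv_cap mem_orthov1.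
  by case/andP=> _ /eqP/dotC0 ->.
have sz : size s = \dim (V :&: orthov dot <[u]>).
  by rewrite -(span_basis bs); apply/esym/eqP/(basis_free bs).
rewrite basisEdim /= sz -dim_orthov_line // leqnn andbT.
apply/subvP => x xV; rewrite span_cons (span_basis bs).
rewrite -[x](subrK (dot x u *: u)) addrC memv_add ?memvZ ?memv_line //.
rewrite memv_cap memvB ?memvZ //= mem_orthov1 linearBl /= linearZl_LR /=.
by rewrite u1 mulr1 subrr.
Qed.

End Orthonormal.

(** * Real and complex scalars *)

(** A complex eigenvector [x] with eigenvalue [l] gives
    [l <x, x> = <x S, x> = <x, x S> = l^* <x, x>], so [l] is real; it is then a
    root of the characteristic polynomial over [R]. *)
Lemma real_symmetric_eigenvalue (R : rcfType) (n : nat) (S : 'M[R]_n) :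
  (0 < n)%N -> S^T = S -> exists a, eigenvalue S a.
Proof.
move=> n_gt0 Ssym; pose S' := map_mx (real_complex R) S.
have [l l_eig] := spectral.eigenvalue_closed S' n_gt0.
have [x xS x0] := eigenvalueP l_eig.
have S'herm : map_mx Num.conj S'^T = S'.
  by apply/matrixP => i j; rewrite !mxE -[in RHS]Ssym mxE [LHS]conjc_real.
pose h := spectral.dotmx x x.
have h0 : h != 0 by rewrite /h dnorm_eq0.
have l_real : Num.conj l = l.
  have lh : spectral.dotmx (l *: x) x = l * h by rewrite linearZl_LR.
  have ljh : spectral.dotmx x (l *: x) = Num.conj l * h by rewrite linearZr_LR.
  apply: (mulIf h0); rewrite -lh -ljh -xS.
  rewrite !spectral.dotmxE trmx_mul map_mxM /= S'herm.
  by rewrite mulmxA.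
have /complex_realP[a la] : l \is Num.real by apply/CrealP.
exists a; rewrite eigenvalue_root_char.
rewrite -(fmorph_root (real_complex R)) map_char_poly -eigenvalue_root_char.
by move: l_eig; rewrite la.
Qed.

Section Scalars.

Variables (R : realType) (s : scalars).
Local Notation K := (scalar_field R s).
Local Notation conj := (scalar_conj R s).
Local Notation toK := (scalar_of_real R s).

Lemma scalar_conj_real r : conj (toK r) = toK r.
Proof. by case: s => //=; exact: conjc_real. Qed.

Lemma scalar_conjK : involutive conj.
Proof. by case: s => //= x; exact: conjCK. Qed.

Lemma scalar_of_real_le (a b : R) : (toK a <= toK b) = (a <= b).
Proof. by case: s => //=; exact: lecR. Qed.

(** In the complex case the order makes a nonnegative scalar real; lengths and
    cosines thus come from [R]. *)
Lemma scalar_ge0_sqr (x : K) : 0 <= x -> exists2 r, 0 <= r & x = toK (r ^+ 2).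
Proof.
case: s x => /= x x0; first by exists (Num.sqrt x); rewrite ?sqrtr_ge0 ?sqr_sqrtr.
have [r xr] := complex_realP x (ger0_real x0); rewrite xr ler0c in x0 *.
by exists (Num.sqrt r); rewrite ?sqrtr_ge0 ?sqr_sqrtr.
Qed.

Lemma scalar_hermitian_eigenvalue (n : nat) (S : 'M[K]_n) :
  (0 < n)%N -> (map_mx conj S)^T = S -> exists a, eigenvalue S a.
Proof.
case: s S => /= S n_gt0 Sherm; last exact: spectral.eigenvalue_closed.
by apply: real_symmetric_eigenvalue => //; rewrite -[RHS]Sherm map_mx_id.
Qed.

End Scalars.

(** * Existence of principal angles *)

Section PrincipalAngles.

Variables (R : realType) (s : scalars) (X : vectType (scalar_field R s)).
Variable dot : {dot X for scalar_conj R s}.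
Local Notation toK := (scalar_of_real R s).
Implicit Types (V W : {vspace X}).

Lemma normalize (u : X) : u != 0 ->
  exists r : R, [/\ 0 < r, dot u u = toK (r ^+ 2) &
    dot ((toK r)^-1 *: u) ((toK r)^-1 *: u) = 1].
Proof.
move=> u0; have [r r0 ur] := scalar_ge0_sqr (dot_ge0 dot u).
have rn0 : r != 0.
  by apply: contraNneq u0 => r00; rewrite -(dot_eq0 dot) ur r00 expr0n rmorph0.
exists r; split => //; first by rewrite lt_def rn0.
rewrite linearZl_LR linearZr_LR /= ur fmorphV scalar_conj_real rmorphXn /=.
have rK0 : toK r != 0 by rewrite fmorph_eq0.
by rewrite mulrA -invfM -expr2 mulVf // expf_neq0.
Qed.

Lemma orthonormal_basis_exists V : exists e : seq X, orthonormal_basis dot V e.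
Proof.
have [n] := ubnP (\dim V); elim: n V => // n IHn V; rewrite ltnS => dimV.
have [V0|V0] := eqVneq V 0%VS.
  by exists [::]; rewrite /orthonormal_basis V0 nil_basis.
have v0 : vpick V != 0 by rewrite vpick0.
have [r [r_gt0 _ u1]] := normalize v0.
set u := _ *: _ in u1.
have uV : u \in V by rewrite memvZ // memv_pick.
have u0 : u != 0 by rewrite -(dot_eq0 dot) u1 oner_eq0.
have [|e /andP[be oe]] := IHn (V :&: orthov dot <[u]>)%VS.
  by rewrite -(dim_orthov_line dot uV u0).
by exists (u :: e); apply/andP; apply: orthonormal_basis_cons.
Qed.

(** The matrix of inner products between bases of [W] and [V] has more rows
    than its rank, so some combination of the basis of [W] is orthogonal to
    [V]. *)
Lemma orthogonal_in_larger V W : (\dim V < \dim W)%N ->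
  exists u, [/\ u \in W, dot u u = 1 & u \in orthov dot V].
Proof.
move=> ltVW; pose N : 'M_(\dim W, \dim V) :=
  \matrix_(i, j) dot (vbasis W)`_i (vbasis V)`_j.
have kerN : kermx N != 0.
  rewrite kermx_eq0 /row_free; apply/negP => /eqP rN.
  by have := rank_leq_col N; rewrite rN leqNgt ltVW.
have x0 : nz_row (kermx N) != 0 by rewrite nz_row_eq0.
have xN : nz_row (kermx N) *m N = 0 by apply/sub_kermxP/nz_row_sub.
move: (nz_row _) x0 xN => x x0 xN.
pose u := \sum_i x 0 i *: (vbasis W)`_i.
have u0 : u != 0.
  apply: contraNneq x0 => u0; apply/eqP/rowP => i; rewrite mxE.
  by move/freeP: (basis_free (vbasisP W)); apply.
have [r [_ _ u1]] := normalize u0.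
exists ((toK r)^-1 *: u); split=> //.
  rewrite memvZ // memv_suml // => i _; rewrite memvZ // vbasis_mem //.
  by rewrite mem_nth // size_tuple.
rewrite memvZ // (mem_orthov_basis (vbasisP V)) // => j.
rewrite (tnth_nth 0) linear_sumlz; move/rowP/(_ j): xN; rewrite !mxE => xNj.
by rewrite -[RHS]xNj; apply: eq_bigr => i _; rewrite linearZl_LR !mxE.
Qed.

Lemma dot_extend V (e : seq X) (a b : X) (c : scalar_field R s) :
  basis_of V e -> {in e, forall u, dot a u = c * dot b u} ->
  {in V, forall u, dot a u = c * dot b u}.
Proof.
move=> be ce u; rewrite -(span_basis be) => /(@coord_span _ _ _ (in_tuple e)) ->.
rewrite !linear_sumr mulr_sumr; apply: eq_bigr => i _.
by rewrite !linearZr_LR /= ce ?mem_nth // mulrCA.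
Qed.

(** Let [u] be a unit eigenvector in [V] of the composite of the projection on
    [W] followed by the projection on [V], and [y] its projection on [W].  If
    [y != 0], take [v = y / |y|] and [c = |y|]: a vector of [W] orthogonal to
    [y] is orthogonal to [u] since it pairs equally with both, and a vector [x]
    of [V] orthogonal to [u] satisfies [<x, y> = l <x, u> = 0].  If [y = 0], then
    [u] is orthogonal to all of [W], and it suffices that [v] be orthogonal to
    the rest of [V], which is possible because that space has smaller dimension
    than [W]. *)
Lemma singular_pair V W : V != 0%VS -> (\dim V <= \dim W)%N ->
  exists (u v : X) (c : R),
  [/\ [/\ u \in V, v \in W, dot u u = 1 & dot v v = 1],
      0 <= c <= 1, dot v u = toK c,
      {in (V :&: orthov dot <[u]>)%VS, forall x, dot v x = 0} &
      {in (W :&: orthov dot <[v]>)%VS, forall y, dot y u = 0}].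
Proof.
move=> V0 leVW.
have [e /andP[be oe]] := orthonormal_basis_exists V.
have [f /andP[bf of_]] := orthonormal_basis_exists W.
pose M := \matrix_(i < size e, j < size f) dot e`_i f`_j.
pose S := M *m (map_mx (scalar_conj R s) M)^T.
have Sherm : (map_mx (scalar_conj R s) S)^T = S.
  rewrite /S map_mxM trmx_mul -map_trmx trmxK -map_mx_comp.
  by congr (_ *m _); apply/matrixP => i j; rewrite !mxE /= scalar_conjK.
have e_gt0 : (0 < size e)%N.
  rewrite lt0n size_eq0; apply: contraNneq V0 => e0.
  by rewrite -(span_basis be) e0 span_nil.
have [l /eigenvalueP[x xS x0]] := scalar_hermitian_eigenvalue e_gt0 Sherm.
pose b := \sum_i x 0 i *: e`_i.
have b0 : b != 0.
  apply: contraNneq x0 => b0; apply/eqP/rowP => i; rewrite mxE.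
  by move/(@freeP _ _ _ (in_tuple e)): (basis_free be); apply.
have bV : b \in V.
  by rewrite -(span_basis be) memv_suml // => i _; rewrite memvZ // memv_span // mem_nth.
have [r [_ _ u1]] := normalize b0.
set u := _ *: b in u1.
have uV : u \in V by rewrite memvZ.
have dot_e i j : (i < size e)%N -> (j < size e)%N -> dot e`_i e`_j = (i == j)%:R.
  case/orthonormal_dotP: oe => ue de ie je.
  by rewrite de ?mem_nth // nth_uniq.
have dot_f i j : (i < size f)%N -> (j < size f)%N -> dot f`_i f`_j = (i == j)%:R.
  case/orthonormal_dotP: of_ => uf df ie je.
  by rewrite df ?mem_nth // nth_uniq.
pose y := \sum_(j < size f) dot u f`_j *: f`_j.
have yW : y \in W.
  by rewrite -(span_basis bf) memv_suml // => i _; rewrite memvZ // memv_span // mem_nth.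
have dot_yW : {in W, forall w, dot y w = dot u w}.
  move=> w wW; rewrite -[RHS]mul1r; apply: (dot_extend bf) wW => _ /(nthP 0)[j jf <-].
  rewrite linear_sumlz (bigD1 (Ordinal jf)) //= big1 => [|k kj].
    by rewrite linearZl_LR /= dot_f // eqxx mulr1 addr0 mul1r.
  rewrite linearZl_LR /= dot_f // (negPf (_ : k != j :> nat)) ?mulr0 //.
have dot_yV : {in V, forall v, dot y v = l * dot u v}.
  apply: (dot_extend be) => _ /(nthP 0)[j je <-].
  have -> : dot u e`_j = (toK r)^-1 * x 0 (Ordinal je).
    rewrite linearZl_LR linear_sumlz (bigD1 (Ordinal je)) //= big1 => [|k kj].
      by rewrite linearZl_LR /= dot_e // eqxx mulr1 addr0.
    by rewrite linearZl_LR /= dot_e // (negPf (_ : k != j :> nat)) ?mulr0.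
  move/rowP/(_ (Ordinal je)): xS; rewrite mulmxA !mxE mulrCA => <-.
  rewrite linear_sumlz mulr_sumr; apply: eq_bigr => k _.
  rewrite linearZl_LR !mxE dot_conj mulrA; congr (_ * _).
  rewrite linearZl_LR linear_sumlz; congr (_ * _).
  by apply: eq_bigr => i _; rewrite linearZl_LR !mxE.
have yy : dot y y = dot u y by exact: dot_yW.
have [y0|y0] := eqVneq y 0.
  have u0 : u != 0 by rewrite -(dot_eq0 dot) u1 oner_eq0.
  have [|v [vW v1 vV]] := @orthogonal_in_larger (V :&: orthov dot <[u]>)%VS W.
    by rewrite -(dim_orthov_line dot uV u0).
  have dot_uW : {in W, forall w, dot w u = 0}.
    by move=> w wW; apply: dotC0; rewrite -dot_yW // y0 linear0l.
  exists u, v, 0; split => //.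
  - by rewrite lexx ler01.
  - by rewrite rmorph0 dot_uW.
  - by move=> z zV; move/mem_orthovP: vV; apply.
  - by move=> w; rewrite memv_cap => /andP[wW _]; exact: dot_uW.
have [c [c0 yyc v1]] := normalize y0.
have cK : toK c != 0 by rewrite fmorph_eq0 gt_eqF.
exists u, ((toK c)^-1 *: y), c; split => //.
- by split=> //; rewrite memvZ.
- rewrite (ltW c0) /= -(@ler_pXn2r _ 2) ?nnegrE ?ler01 ?(ltW c0) // expr1n.
  rewrite -(scalar_of_real_le s) -yyc rmorph1 -u1 -subr_ge0.
  have yu : dot y u = dot y y by rewrite -(dot_conj dot u y) -yy dot_conj.
  have := dot_ge0 dot (u - y).
  by rewrite linearBl !linearBr /= yu -yy subrr subr0.
- rewrite linearZl_LR /= -(dot_conj dot u y) -yy dot_conj yyc rmorphXn /=.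
  by rewrite expr2 mulKf.
- move=> z; rewrite memv_cap mem_orthov1 => /andP[zV /eqP zu].
  by rewrite linearZl_LR /= dot_yV // (dotC0 zu) !mulr0.
- move=> z; rewrite memv_cap mem_orthov1 => /andP[zW].
  rewrite linearZr_LR /= mulf_eq0 fmorph_eq0 invr_eq0 (negPf cK) /= => /eqP zy.
  by apply: dotC0; rewrite -dot_yW // dotC0.
Qed.

Lemma size_orthonormal_basis V (e : seq X) :
  orthonormal_basis dot V e -> size e = \dim V.
Proof.
by case/andP=> be _; rewrite -(span_basis be); apply/esym/eqP/(basis_free be).
Qed.

Lemma acos_quadrant (c : R) :
  0 <= c <= 1 -> 0 <= acos c <= pi / 2 /\ cos (acos c) = c.
Proof.
case/andP=> c0 c1.
have cN11 : -1 <= c <= 1 by rewrite c1 (le_trans _ c0) ?lerN10.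
have [/andP[a0 api] ca] := acos_def cN11.
split=> //; rewrite a0 leNgt; apply/negP => lta.
have pi0 := pi_ge0 R.
have : cos (acos c) < cos (pi / 2).
  rewrite ltr_cos // in_itv /= ?a0 ?api ?divr_ge0 //.
  by rewrite ler_pdivrMr // ler_peMr // ler1n.
by rewrite cos_pihalf ca ltNge c0.
Qed.

(** A singular value decomposition kept as a list of triples (vector of [V],
    vector of [W], angle), with [t] completing the basis of [W].  The relations
    between the members of the list do not refer to positions, so that the list
    can be sorted afterwards. *)
Lemma singular_system V W : (\dim V <= \dim W)%N ->
  exists (L : seq (X * X * R)) (t : seq X),
  [/\ orthonormal_basis dot V [seq x.1.1 | x <- L],
      orthonormal_basis dot W ([seq x.1.2 | x <- L] ++ t),
      {in L, forall x, 0 <= x.2 <= pi / 2},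
      {in L &, forall x y,
        dot y.1.2 x.1.1 = if x == y then toK (cos x.2) else 0} &
      {in L & t, forall x z, dot z x.1.1 = 0}].
Proof.
have [n] := ubnP (\dim V); elim: n V W => // n IHn V W; rewrite ltnS => dimV leVW.
have [V0|V0] := eqVneq V 0%VS.
  have [t bt] := orthonormal_basis_exists W.
  by exists [::], t; rewrite /orthonormal_basis V0 nil_basis.
have [u [v [c [[uV wW u1 v1] c01 vu vV' uW']]]] := singular_pair V0 leVW.
have u0 : u != 0 by rewrite -(dot_eq0 dot) u1 oner_eq0.
have v0 : v != 0 by rewrite -(dot_eq0 dot) v1 oner_eq0.
have dV := dim_orthov_line dot uV u0.
have dW := dim_orthov_line dot wW v0.
set V' := (V :&: _)%VS in dV vV'; set W' := (W :&: _)%VS in dW uW'.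
have [||L [t [/andP[bV' oV'] /andP[bW' oW'] angL dotL dott]]] := IHn V' W'.
- by rewrite -ltnS -dV.
- by rewrite -ltnS -dV -dW.
have LV' x : x \in L -> x.1.1 \in V'.
  by move=> xL; rewrite -(span_basis bV') memv_span // (map_f (fun x => x.1.1)).
have LW' x : x \in L -> x.1.2 \in W'.
  move=> xL; rewrite -(span_basis bW') memv_span // mem_cat.
  by rewrite (map_f (fun x => x.1.2)).
have [ac0 acK] := acos_quadrant c01.
have [bV oV] := orthonormal_basis_cons uV u1 bV' oV'.
have [bW oW] := orthonormal_basis_cons wW v1 bW' oW'.
(* The head triple differs from those of L, since its first vector is not
   repeated in the orthonormal basis of V. *)
have uL (x : X * X * R) : x \in L -> (u == x.1.1) = false.
  case/orthonormal_dotP: oV => /= /andP[uNL _] _ xL; apply: contraNF uNL => /eqP ->.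
  exact: map_f.
exists ((u, v, acos c) :: L), t; split.
- exact/andP.
- exact/andP.
- by move=> x; rewrite inE => /predU1P[->|/angL].
- move=> x y; rewrite !inE => /predU1P[->|xL] /predU1P[->|yL] /=.
  + by rewrite eqxx acK.
  + by rewrite -pair_eqE /= -pair_eqE /= uL // uW' ?LW'.
  + by rewrite eq_sym -pair_eqE /= -pair_eqE /= uL // vV' ?LV'.
  + exact: dotL.
- move=> x z; rewrite inE => /predU1P[->|xL] zt /=; last exact: dott.
  by rewrite uW' // -(span_basis bW') memv_span // mem_cat zt orbT.
Qed.

Lemma principal_angles_exist V W : (\dim V <= \dim W)%N ->
  exists theta : (minn (\dim V) (\dim W)).-tuple R,
    is_principal_angles dot (V := V) (W := W) theta.
Proof.
move=> leVW; have [L0 [t [bV bW angL dotL dott]]] := singular_system leVW.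
pose le_angle (x y : X * X * R) := x.2 <= y.2.
have le_angle_total : total le_angle by move=> x y; exact: le_total.
have [L [permL sortedL]] : exists L, perm_eq L0 L /\ sorted le_angle L.
  by exists (sort le_angle L0); rewrite perm_sym perm_sort sort_sorted.
have memL := perm_mem permL.
have perm_onb U (a b : seq X) : perm_eq a b ->
    orthonormal_basis dot U a -> orthonormal_basis dot U b.
  move=> pab /andP[ba oa]; apply/andP.
  by rewrite -(perm_basis _ pab) (perm_orthonormal pab).
have {}bV : orthonormal_basis dot V [seq x.1.1 | x <- L].
  exact: perm_onb (perm_map _ permL) bV.
have {}bW : orthonormal_basis dot W ([seq x.1.2 | x <- L] ++ t).
  by apply: perm_onb bW; rewrite perm_cat2r perm_map.
have sizeL : size L = \dim V by rewrite -(size_orthonormal_basis bV) size_map.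
have size_theta : size [seq x.2 | x <- L] == minn (\dim V) (\dim W).
  by rewrite size_map sizeL (minn_idPl leVW).
have size_e : size [seq x.1.1 | x <- L] == \dim V by rewrite size_map sizeL.
have size_f : size ([seq x.1.2 | x <- L] ++ t) == \dim W.
  by rewrite (size_orthonormal_basis bW).
have uniqL : uniq L.
  by case/andP: bV => _ /orthonormal_dotP[/map_uniq].
exists (Tuple size_theta); split.
- move=> i; have : tnth (Tuple size_theta) i \in [seq x.2 | x <- L] by exact: mem_tnth.
  by case/mapP=> x; rewrite -memL => /angL ? ->.
- by rewrite sorted_map.
exists (Tuple size_e), (Tuple size_f); split=> // i j.
have ltiL : (i < size L)%N by rewrite sizeL.
pose x0 : X * X * R := (0, 0, 0).
rewrite /inner !(tnth_nth 0) /= nth_cat size_map !(nth_map x0 _ _ ltiL).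
case: ltnP => [ltjL|leLj].
  rewrite (nth_map x0) // dotL ?memL ?mem_nth // nth_uniq //.
rewrite dott ?memL ?mem_nth //; last first.
  by rewrite ltn_subLR // -(size_map (fun x => x.1.2)) -size_cat (eqP size_f).
by case: eqP => // ij; rewrite -ij leqNgt ltiL in leLj.
Qed.

End PrincipalAngles.

(** * The Grassmann angle as a contraction factor *)

Section ProjectionFactor.

Variables (R : realType) (s : scalars) (X : vectType (scalar_field R s)).
Variable dot : {dot X for scalar_conj R s}.
Local Notation toK := (scalar_of_real R s).
Implicit Types (V W : {vspace X}).

Lemma cos_grassmann_angle_eq0 V W : (\dim W < \dim V)%N ->
  cos (grassmann_angle dot V W) = 0.
Proof.
move=> ltWV; rewrite /grassmann_angle.
case: eqP => [V0|_]; first by rewrite V0 dimv0 in ltWV.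
case: ifP => _; first exact: cos_pihalf.
by rewrite [(_ <= _)%N]leqNgt ltWV; exact: cos_pihalf.
Qed.

(** The bases that witness principal angles are what a computation needs, so
    the chosen angles are returned with their defining property. *)
Lemma cos_grassmann_angle_prod V W : V != 0%VS -> (\dim V <= \dim W)%N ->
  exists theta : (minn (\dim V) (\dim W)).-tuple R,
    is_principal_angles dot (V := V) (W := W) theta /\
    cos (grassmann_angle dot V W) = \prod_(i < \dim V) cos theta`_i.
Proof.
move=> V0 leVW; exists (principal_angles dot V W).
have ang : is_principal_angles dot (principal_angles dot V W).
  exact: (xgetPex _ (principal_angles_exist dot leVW)).
split=> //; have W0 : W != 0%VS.
  by apply: contraNneq V0 => W0; rewrite -dimv_eq0 -leqn0; move: leVW; rewrite W0 dimv0.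
rewrite /grassmann_angle (negPf V0) (negPf W0) leVW acosK; last first.
  have cos01 t : t \in principal_angles dot V W -> 0 <= cos t <= 1.
    case: ang => ang _ _ /tnthP[i ->]; have /andP[t0 tpi] := ang i.
    by rewrite cos_le1 cos_ge0_pihalf // tpi andbT (le_trans _ t0) // oppr_le0
               divr_ge0 // pi_ge0.
  have prod_ge0 : 0 <= \prod_(t <- principal_angles dot V W) cos t.
    by rewrite big_seq prodr_ge0 // => t /cos01/andP[].
  rewrite in_itv /= (le_trans _ prod_ge0) ?lerN10 //=.
  by rewrite big_seq prodr_ile1.
rewrite (big_nth 0) size_tuple; move: (tval _) => t.
by rewrite (minn_idPl leVW) big_mkord.
Qed.

(** The hypotheses say that [u j] is the orthogonal projection of [tnth v j] on
    [W]; the squared cosine of the Grassmann angle is the factor by which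
    projecting contracts squared volumes. *)
Lemma cos_grassmann_angle_gram V W p (v : p.-tuple X) (u : 'I_p -> X) :
  basis_of V v -> (forall j, u j \in W) ->
  (forall j, {in W, forall x, dot x (u j) = dot x (tnth v j)}) ->
  toK (cos (grassmann_angle dot V W) ^+ 2) * \det (gram dot (tnth v) (tnth v))
  = \det (gram dot u u).
Proof.
move=> bv uW uv; have pV : \dim V = p by rewrite (size_basis bv).
have [V0|V0] := eqVneq V 0%VS.
  have p0 : p = 0%N by rewrite -pV V0 dimv0.
  move: v u {bv uW uv}; rewrite p0 => v u.
  by rewrite !det_mx00 mulr1 /grassmann_angle V0 eqxx cos0 expr1n rmorph1.
have [leVW|ltWV] := leqP (\dim V) (\dim W); last first.
  rewrite cos_grassmann_angle_eq0 // expr0n rmorph0 mul0r; apply/esym/eqP.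
  (* The Gram matrix factors through a space of dimension \dim W < p. *)
  rewrite (lincomb_coord (vbasisP W) uW) gram_lincomb -mulmxA.
  apply: contraTT ltWV; rewrite -unitfE -unitmxE -row_free_unit /row_free -leqNgt pV.
  move=> /eqP {1}<-; rewrite (leq_trans (mxrankM_maxl _ _)) //.
  exact: rank_leq_col.
have [theta [[_ _ [e [f [/andP[be oe] /andP[bf of_] ef]]]] ->]] :=
  cos_grassmann_angle_prod V0 leVW.
subst p.
(* E is the matrix of the projection in the principal bases, P expresses v in e
   and Y expresses u in f, whence Y = P E. *)
pose E : 'M_(_, _) := (gram dot (tnth f) (tnth e))^T.
have E_entry i j : E i j = if i == j :> nat then toK (cos theta`_i) else 0.
  rewrite !mxE -dot_conj; have := ef i j; rewrite /inner => ->.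
  by case: eqP; rewrite ?scalar_conj_real ?rmorph0.
have vE := lincomb_coord be (fun j => basis_mem bv (mem_tnth j v)).
have uE := lincomb_coord bf uW.
move: (\matrix_(_, _) _) (\matrix_(_, _) _) vE uE => Y P vE uE.
have YE : Y = P *m E.
  apply: trmx_inj; rewrite trmx_mul trmxK -gram_lincombr -vE.
  rewrite -[LHS]mul1mx -(gram_orthonormal of_) -gram_lincombr -uE.
  apply/matrixP => i j; rewrite !mxE -dot_conj uv ?dot_conj //.
  exact: basis_mem bf (mem_tnth _ _).
have EE : map_mx (scalar_conj R s) E *m E^T =
    diag_mx (\row_i toK (cos theta`_i ^+ 2)).
  apply/matrixP => i k; rewrite !mxE (bigD1 (widen_ord leVW i)) //=.
  rewrite big1 => [|j ij]; last first.
    rewrite mxE E_entry; case: eqP => [ij'|_]; last by rewrite rmorph0 mul0r.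
    by case/eqP: ij; apply: val_inj.
  rewrite addr0 mxE [E^T _ _]mxE !E_entry /= eqxx scalar_conj_real eq_sym -val_eqE /=.
  by case: eqP => [->|_]; rewrite ?mulr0 // rmorphXn.
rewrite {1 2}vE {1 2}uE !gram_lincomb !gram_orthonormal // !mulmx1 YE.
rewrite map_mxM trmx_mul -mulmxA (mulmxA _ E^T) EE !det_mulmx det_diag.
rewrite mulrCA; congr (_ * (_ * _)).
rewrite -prodrXl rmorph_prod; apply: eq_bigr => i _.
by rewrite mxE.
Qed.

End ProjectionFactor.

Theorem theorem6p5 (R : realType) (s : scalars)
    (X : vectType (scalar_field R s)) (dot : {dot X for scalar_conj R s})
    (V W : {vspace X}) (p q : nat) (v : p.-tuple X) (w : q.-tuple X)
    (v_basis : basis_of V v) (w_basis : basis_of W w) :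
  let A := \matrix_(i < q, j < q) inner dot (tnth w i) (tnth w j) in
  let B := \matrix_(i < q, j < p) inner dot (tnth w i) (tnth v j) in
  let D := \matrix_(i < p, j < p) inner dot (tnth v i) (tnth v j) in
  scalar_of_real R s (cos (compl_grassmann_angle dot V W) ^+ 2) =
  \det (A - B *m invmx D *m (map_mx (scalar_conj R s) B)^T) / \det A.
Proof.
move=> A B D.
have uA : A \in unitmx := free_gram_unit dot (basis_free w_basis).
have uD : D \in unitmx := free_gram_unit dot (basis_free v_basis).
have dA : \det A != 0 by rewrite -unitfE -unitmxE.
have dD : \det D != 0 by rewrite -unitfE -unitmxE.
have BC : (map_mx (scalar_conj R s) B)^T = gram dot (tnth v) (tnth w).
  exact: gram_conj.
apply: (mulIf dA); rewrite divfK //; apply: (mulfI dD).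
rewrite -(det_schur_exchange _ _ uA uD) BC mulrA mulrC; congr (_ * _).
pose u := residual dot (tnth v) w.
have uW j : u j \in orthov dot W by exact: residual_orthov.
have uv j : {in orthov dot W, forall x, dot x (u j) = dot x (tnth v j)}.
  by move=> x; exact: orthov_dot_residual.
have := cos_grassmann_angle_gram v_basis uW uv.
by rewrite (gram_residual dot (tnth v) w_basis) mulrC => <-; rewrite mulrC.
Qed.
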